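(* Let $p$ be an odd prime, let $k\in\mathbb{N}$ be relatively prime to $p$, and suppose $p$ has odd order in $(\mathbb{Z}/k\mathbb{Z})^\times$. If $c$ is the least nonnegative integer such that $\gamma_p(k)\leq 2^c+1$, then \[ v(p,k)\leq 2^{c+1}+\mathbf{1}_{2^c+1}(\gamma_p(k))<4\gamma_p(k). \]
   Context: Let $F$ be an algebraically closed field of characteristic $p>0$. For $k\in\mathbb{N}$, $v(p,k)$ denotes the smallest natural number $s$ such that every polynomial in $F[t]$ can be written as a sum of at most $s$ $k$-th powers of polynomials in $F[t]$ (with no restriction on the degrees of the polynomials being raised to the $k$-th power); if no such $s$ exists, $v(p,k)=\infty$. For an integer $q\geq 2$, $\gamma_q(k)$ denotes the sum of the digits of the base-$q$ expansion of $k$. The indicator function is $\mathbf{1}_M(x)=1$ if $x=M$ and $\mathbf{1}_M(x)=0$ if $x\neq M$. *)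

(* Defs.v *)
From HB Require Import structures.
From mathcomp Require Import all_boot all_order all_algebra.
Set Implicit Arguments. Unset Strict Implicit. Unset Printing Implicit Defensive.
Import GRing.Theory.

(* Sum of base-q digits of n (fuel = n suffices for q >= 2). *)
Fixpoint digit_sum_aux (q fuel n : nat) : nat :=
  match fuel with
  | 0 => 0
  | S f => if n is 0 then 0 else (n %% q + digit_sum_aux q f (n %/ q))%N
  end.
Definition digit_sum (q n : nat) : nat := digit_sum_aux q n n.

Definition is_order_mod (k p m : nat) : Prop :=
  [/\ 0 < m, p ^ m = 1 %[mod k] &
      forall j, 0 < j -> p ^ j = 1 %[mod k] -> m <= j]%N.

Definition sum_kth_powers_le (F : nzRingType) (k s : nat) (f : {poly F}) : Prop :=
  exists g : seq {poly F}, (size g <= s)%N /\ f = (\sum_(x <- g) x ^+ k)%R.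

(* v(p,k) <= s, where F has characteristic p:  every polynomial is a sum of
   at most s k-th powers (v is the least such s). *)
Definition waring_le (F : nzRingType) (k s : nat) : Prop :=
  forall f : {poly F}, sum_kth_powers_le k s f.

(* Main.v *)
(* Put n = 2^c and write k as a sum of gamma = gamma_p(k) powers p^e. Since p
   has odd order m mod k, each e can be replaced by some h e = e mod m with
   h 0 = 0 and h e an odd multiple of n for e > 0. The sum K of the p^(h e) is
   then a multiple of k, so K-th powers are k-th powers, and p^(h e) = 1 mod n.
   By the Frobenius, (1 + zy)^K is the product of the 1 + z^(p^(h e)) y^(p^(h e)),
   so averaging z^-1 (1 + zy)^K over the n-th roots of unity z keeps only the
   subset products of size 1 mod n: since gamma <= n + 1, these give the additive
   polynomial L(y), plus y^K when gamma = n + 1 (and a constant when n = 1).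
   If r^(p^n) = -r, then r^(p^(h e)) = -r for e > 0, so in L(y) + r^-1 L(ry) all
   terms cancel but those with e = 0, leaving 2 (k mod p) y with y arbitrary. *)
Require Import Defs.
From mathcomp Require Import all_boot all_order all_algebra.
From mathcomp Require Import zify ring.
Set Implicit Arguments. Unset Strict Implicit. Unset Printing Implicit Defensive.
Import GRing.Theory.

(** * Base-p exponents and congruences for powers of p *)

(** Exponents are listed with multiplicity. The last digit of [k] counts the zeros, which are the
    exponents whose terms survive as linear terms. *)
Lemma digit_exponents (q k : nat) : 1 < q ->
  exists s : seq nat, [/\ size s = digit_sum q k, \sum_(e <- s) q ^ e = k
    & count_mem 0 s = k %% q].
Proof.
move=> q_gt1; rewrite /digit_sum; have := leqnn k.
move: {2 3}k => f; elim: f k => [|f IHf] [|k] //= le_kf.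
- by exists [::]; split; rewrite ?big_nil ?mod0n.
- by exists [::]; split; rewrite ?big_nil ?mod0n.
have le_df : k.+1 %/ q <= f by have := ltn_Pdiv q_gt1 (ltn0Sn k); lia.
have [s [size_s sum_s _]] := IHf _ le_df.
exists (nseq (k.+1 %% q) 0 ++ map S s); split.
- by rewrite size_cat size_nseq size_map size_s.
- rewrite big_cat big_map big_nseq iter_addn_0 /= expn0 mul1n.
  under eq_bigr do rewrite expnS.
  by rewrite -big_distrr /= sum_s addnC mulnC -divn_eq.
- rewrite count_cat count_nseq /= mul1n count_map.
  by rewrite (eq_count (a2 := pred0)) // count_pred0 addn0.
Qed.

Lemma dvdn_pow2_order (p c : nat) : odd p -> 2 ^ c %| p ^ (2 ^ c) - 1.
Proof.
move=> odd_p; elim: c => [|c IHc]; first by rewrite dvd1n.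
rewrite !(expnSr 2) expnM -(exp1n 2) subn_sqr exp1n dvdn_mul // dvdn2 oddD.
by rewrite oddX odd_p orbT.
Qed.

Lemma expn_eq1_mod (p n e d : nat) :
  p ^ n = 1 %[mod d] -> n %| e -> p ^ e = 1 %[mod d].
Proof. by move=> pn1 /dvdnP[j ->]; rewrite mulnC expnM -modnXm pn1 modnXm exp1n. Qed.

Lemma expn_eq_mod (p m k a b : nat) :
  p ^ m = 1 %[mod k] -> a = b %[mod m] -> p ^ a = p ^ b %[mod k].
Proof.
move=> pm1 eq_ab; rewrite (divn_eq a m) (divn_eq b m) eq_ab !expnD.
rewrite -modnMml (expn_eq1_mod pm1 (dvdn_mull _ (dvdnn m))) modnMml.
by rewrite -[RHS]modnMml (expn_eq1_mod pm1 (dvdn_mull _ (dvdnn m))) modnMml.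
Qed.

(** Since [m] is odd, the Chinese remainder theorem applies to [m] and [2 ^ c.+1]. The residue
    [2 ^ c] modulo [2 ^ c.+1] characterises the odd multiples of [2 ^ c]. *)
Lemma exponent_shift (p k m c : nat) : p ^ m = 1 %[mod k] -> odd m ->
  exists h : nat -> nat, forall e,
    [/\ p ^ h e = p ^ e %[mod k], (h e == 0) = (e == 0), 2 ^ c %| h e
      & 0 < e -> odd (h e %/ 2 ^ c)].
Proof.
move=> pm1 odd_m; have n_gt0 : 0 < 2 ^ c by rewrite expn_gt0.
have co : coprime m (2 ^ c.+1) by rewrite coprimeXr // coprimen2.
exists (fun e => if e == 0 then 0 else chinese m (2 ^ c.+1) e (2 ^ c)).
move=> e; case: eqVneq => [->|e_neq0]; first by rewrite dvdn0.
set x := chinese _ _ _ _.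
have x1 : x = e %[mod m] by apply: chinese_modl.
have : x %% 2 ^ c.+1 = 2 ^ c.
  rewrite (chinese_modr co) modn_small // expnS; lia.
move=> x2; have def_x : x = (x %/ 2 ^ c.+1 * 2).+1 * 2 ^ c.
  by rewrite {1}(divn_eq x (2 ^ c.+1)) x2 mulSn expnS mulnA addnC.
split; first exact: expn_eq_mod x1.
- by rewrite def_x muln_eq0 /=; apply/negbTE; rewrite -lt0n.
- by rewrite def_x dvdn_mull.
- by rewrite {1}def_x mulnK //= oddM andbF.
Qed.

(** * Filtering by roots of unity *)

Section SumsOfPowers.
Local Open Scope ring_scope.

Lemma prim_root_sum (R : idomainType) (n j : nat) (z : R) :
  n.-primitive_root z ->
  \sum_(i < n) z ^+ (i * j) = if (n %| j)%N then n%:R else 0.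
Proof.
move=> prim_z; have := subrX1 (z ^+ j) n.
rewrite exprAC (prim_expr_order prim_z) expr1n subrr.
under eq_bigr do rewrite -exprM mulnC.
rewrite (prim_order_dvd prim_z); case: eqP => [zj1 _ | /eqP zj1 /esym/eqP].
  under eq_bigr do rewrite mulnC exprM zj1 expr1n.
  by rewrite sumr_const card_ord.
by rewrite mulf_eq0 subr_eq0 (negbTE zj1) => /eqP.
Qed.

(** The index condition is [#|S|] = 1 mod [n], written without a truncated [#|S| - 1]. Up to n + 1,
    the sizes allowed are 1 and n + 1, and also 0 when n = 1. *)
Lemma sum_subsets_dvd (V : nmodType) (n g : nat) (f : {set 'I_g} -> V) :
  (0 < n)%N -> (0 < g <= n + 1)%N ->
  \sum_(S : {set 'I_g} | (n %| #|S| + (n - 1))%N) f S =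
    f set0 *+ (n == 1)%N + \sum_l f [set l] + f setT *+ (g == n + 1)%N.
Proof.
move=> n_gt0 /andP[g_gt0 g_le].
have le_card (S : {set 'I_g}) : (#|S| <= g)%N.
  by rewrite -[g in (_ <= g)%N]card_ord max_card.
have dvdE (S : {set 'I_g}) : (n %| #|S| + (n - 1))%N =
    [|| (#|S| == 1)%N, (#|S| == 0)%N && (n == 1)%N
      | (#|S| == n + 1)%N].
  apply/idP/idP => [/dvdnP[j def_j] | ]; last first.
    case/or3P=> [/eqP-> | /andP[/eqP-> /eqP->] | /eqP->] //.
      by rewrite subnKC.
    by rewrite -addnA subnKC // dvdn_add.
  (* Quotients 0, 1, 2 give the sizes 0 (with n = 1), 1 and n + 1; a larger quotient needs a size of
     at least 2n + 1, beyond [g]. *)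
  have := le_card S; case: j def_j => [|[|[|j]]] def_j; nia.
rewrite (eq_bigl _ _ dvdE) (bigID (fun S : {set 'I_g} => #|S| == 1)%N) /=.
rewrite (eq_bigl (fun S : {set 'I_g} => #|S| == 1)%N); last first.
  by move=> S; case: (#|S| == 1)%N; rewrite ?andbF.
rewrite big_cards1 addrAC addrC; congr (_ + _).
rewrite (bigID (fun S : {set 'I_g} => S == set0)) /=.
congr (_ + _).
  case: (eqVneq n 1%N) => [n1 | n_neq1].
    rewrite (big_pred1 set0) // => S /=; case: (eqVneq S set0) => [->|];
      last by rewrite andbF.
    by rewrite cards0.
  rewrite big_pred0 // => S; case: (eqVneq S set0) => [->|];
      last by rewrite andbF.
  by rewrite cards0; apply/negbTE; lia.
case: (eqVneq g (n + 1)%N) => [def_g | g_neq].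
  rewrite (big_pred1 setT) // => S /=; rewrite -cards_eq0.
  rewrite eqEcard subsetT cardsT card_ord /=.
  by move: (le_card S); move: #|S| => s; clear -n_gt0 def_g; lia.
rewrite big_pred0 // => S; rewrite -cards_eq0.
by move: (le_card S); move: #|S| => s; clear -n_gt0 g_le g_neq; lia.
Qed.

(* Every [p ^ e l] is 1 mod n, so substituting z u for u multiplies the subset
   product over S by [z ^+ #|S|]. *)
Lemma root_of_unity_filter (R : idomainType) (p n g : nat) (e : 'I_g -> nat)
    (z u : R) :
  p \in [pchar R] -> n.-primitive_root z -> (0 < g <= n + 1)%N ->
  (forall l, p ^ e l = 1 %[mod n])%N ->
  \sum_(i < n) z ^+ (i * (n - 1)) * (1 + z ^+ i * u) ^+ (\sum_l p ^ e l) =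
  n%:R * ((n == 1)%N%:R + \sum_l u ^+ (p ^ e l)
          + u ^+ (\sum_l p ^ e l) *+ (g == n + 1)%N).
Proof.
move=> charR prim_z g_le pe1; have n_gt0 := prim_order_gt0 prim_z.
have expand (i : 'I_n) :
    (1 + z ^+ i * u) ^+ (\sum_l p ^ e l) =
    \sum_(S : {set 'I_g}) z ^+ (i * #|S|) * \prod_(l in S) u ^+ (p ^ e l).
  rewrite -prodrXr (eq_bigr (fun l => z ^+ i * u ^+ (p ^ e l) + 1)); last first.
    move=> l _; rewrite exprDn_pchar ?expr1n 1?addrC; last first.
      apply/andP; split; first by rewrite expn_gt0 prime_gt0 ?(pcharf_prime charR).
      apply/allP=> r; rewrite mem_primes => /and3P[pr_r _].
      rewrite Euclid_dvdX // => /andP[r_p _].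
      by move: r_p; rewrite dvdn_prime2 ?(pcharf_prime charR) // => /eqP->.
    rewrite exprMn -exprM -(prim_expr_mod prim_z) -modnMmr pe1 modnMmr muln1.
    by rewrite (prim_expr_mod prim_z).
  rewrite bigA_distr; apply: eq_big => // S _.
  by rewrite -big_mkcond /= big_split /= prodr_const exprM.
under [LHS]eq_bigr => i _ do rewrite expand mulr_sumr.
rewrite exchange_big /=.
rewrite (eq_bigr (fun S : {set 'I_g} => if (n %| #|S| + (n - 1))%N then
    n%:R * \prod_(l in S) u ^+ (p ^ e l) else 0)); last first.
  move=> S _; under eq_bigr => i _ do rewrite mulrA -exprD -mulnDr addnC.
  by rewrite -mulr_suml (prim_root_sum _ prim_z); case: ifP; rewrite ?mul0r.
rewrite -big_mkcond -mulr_sumr sum_subsets_dvd //; congr (_ * _).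
rewrite big_set0; congr (_ + _ + _).
  by apply: eq_bigr => l _; rewrite big_set1.
by congr (_ *+ _); rewrite -prodrXr; apply: eq_bigl => l; rewrite inE.
Qed.

(** * Roots in an algebraically closed field *)

Lemma closed_pow_root (F : closedFieldType) (n : nat) (a : F) :
  (0 < n)%N -> exists x, x ^+ n = a.
Proof.
move=> n_gt0; have [x def_x] := solve_monicpoly (fun i => a *+ (i == 0)%N) n_gt0.
exists x; rewrite def_x; case: n n_gt0 {def_x} => // n _.
by rewrite big_ord_recl big1 ?addr0 /= ?mulr1 // => i _; rewrite mul0r.
Qed.

(** For positive [c], a root of x^(2^(c-1)) = -1 has order dividing 2^c but not 2^(c-1), because -1
    differs from 1. *)
Lemma prim_root_pow2_exists (F : closedFieldType) (c : nat) :
  2%:R != 0 :> F -> exists z : F, (2 ^ c)%N.-primitive_root z.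
Proof.
move=> nz2; case: c => [|c].
  by exists 1; have [[|[|]] //] := prim_order_exists (ltn0Sn 0) (expr1n F 1).
have [|z def_z] := @closed_pow_root F (2 ^ c)%N (-1); first by rewrite expn_gt0.
have [||m prim_z dvd_m] := @prim_order_exists F (2 ^ c.+1)%N z.
- by rewrite expn_gt0.
- by rewrite expnSr exprM def_z sqrrN expr1n.
exists z; case/(dvdn_pfactor _ _ (isT : prime 2)): dvd_m => j le_jc def_m.
suff -> : c.+1 = j by rewrite -def_m.
apply/eqP; rewrite eqn_leq le_jc andbT ltnNge; apply/negP => le_j_c.
have := prim_order_dvd prim_z (2 ^ c)%N.
rewrite def_m dvdn_exp2l // def_z => /esym/eqP/(congr1 (+%R^~ 1)).
by rewrite addNr => /esym/eqP; apply/negP.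
Qed.

(** * Combining k-th powers *)

Lemma sum_kth_powers_leD (F : nzRingType) (k s t : nat) (f g : {poly F}) :
  sum_kth_powers_le k s f -> sum_kth_powers_le k t g ->
  sum_kth_powers_le k (s + t) (f + g).
Proof.
move=> [u [le_u ->]] [v [le_v ->]]; exists (u ++ v).
by rewrite size_cat leq_add // big_cat.
Qed.

Lemma sum_kth_powers_le_sum (F : nzRingType) (k n : nat) (f : 'I_n -> {poly F}) :
  (forall i, sum_kth_powers_le k 1 (f i)) ->
  sum_kth_powers_le k n (\sum_(i < n) f i).
Proof.
elim: n f => [|n IHn] f Hf; first by exists [::]; rewrite big_ord0 big_nil.
by rewrite big_ord_recl; apply: (@sum_kth_powers_leD _ _ 1 n) => //; apply: IHn.
Qed.

(** Scalars are free: [a] has a k-th root in [F], which is absorbed into the base. *)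
Lemma scaled_power (F : closedFieldType) (k K : nat) (a : F) (g : {poly F}) :
  (0 < k)%N -> (k %| K)%N -> sum_kth_powers_le k 1 (a%:P * g ^+ K).
Proof.
move=> k_gt0 /dvdnP[j ->]; have [b <-] := closed_pow_root a k_gt0.
by exists [:: b%:P * g ^+ j]; rewrite big_seq1 exprMn exprM -rmorphXn.
Qed.

End SumsOfPowers.

Theorem theorem2 (F : closedFieldType) (p k c : nat)
  (hp : prime p) (hodd : odd p) (hchar : (p \in [pchar F])%R)
  (hcop : coprime k p)
  (hord : exists m, is_order_mod k p m /\ odd m)
  (hc : digit_sum p k <= 2 ^ c + 1)
  (hcmin : forall c', c' < c -> ~ (digit_sum p k <= 2 ^ c' + 1)) :
  waring_le F k (2 ^ c.+1 + (digit_sum p k == 2 ^ c + 1)) /\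
  2 ^ c.+1 + (digit_sum p k == 2 ^ c + 1) < 4 * digit_sum p k.
Proof.
have k_gt0 : 0 < k.
  rewrite lt0n; apply: contraTneq hcop => ->; rewrite /coprime gcd0n neq_ltn.
  by rewrite prime_gt1 ?orbT.
have p_gt1 := prime_gt1 hp.
have [s [size_s sum_s count_s]] := digit_exponents k p_gt1.
rewrite -size_s in hc hcmin *.
have s_gt0 : 0 < size s.
  by case: s sum_s {size_s count_s hc hcmin} => //; rewrite big_nil; lia.
split; last first.
  (* For c = 0 only the digit sums 1 and 2 occur; otherwise minimality makes the digit sum at least
     2^(c-1) + 2, and four times this is 2^(c+1) + 8. *)
  case: c hc hcmin => [|c'] Hc Hcmin; first by rewrite expn0 in Hc *; lia.
  by have := Hcmin c' (ltnSn _); rewrite !expnS; lia.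
have [m [[_ pm1 _] odd_m]] := hord.
have [h h_spec] := exponent_shift c pm1 odd_m.
set n := 2 ^ c; have n_gt0 : 0 < n by rewrite expn_gt0.
pose e (l : 'I_(size s)) := h (nth 0 s l).
pose K := \sum_l p ^ e l.
have dvd_kK : k %| K.
  rewrite /dvdn /K -modn_summ.
  rewrite (eq_bigr (fun l : 'I_(size s) => p ^ nth 0 s l %% k)); last first.
    by move=> l _; have [] := h_spec (nth 0 s l).
  rewrite modn_summ.
  rewrite -(big_mkord xpredT (fun i => p ^ nth 0 s i)) -(big_nth 0 xpredT).
  by rewrite sum_s modnn.
have pn1 : p ^ n = 1 %[mod n].
  by apply/eqP; rewrite eqn_mod_dvd ?dvdn_pow2_order // expn_gt0 ltnW.
have pe1 l : p ^ e l = 1 %[mod n].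
  by have [_ _ dvd_h _] := h_spec (nth 0 s l); apply: expn_eq1_mod pn1 dvd_h.
have p_ndvd_pow2 j : ~~ (p %| 2 ^ j).
  apply/negP; rewrite Euclid_dvdX // => /andP[]; rewrite dvdn_prime2 // => /eqP p2.
  by rewrite p2 in hodd.
have nat_neq0 j : (j%:R != 0 :> F)%R = ~~ (p %| j) by rewrite (dvdn_pcharf hchar).
have [z prim_z] : exists z : F, (n.-primitive_root z)%R.
  by apply: prim_root_pow2_exists; rewrite nat_neq0 (p_ndvd_pow2 1).
have q_gt1 : 1 < p ^ n by rewrite -(expn0 p) ltn_exp2l.
have [r r_pow] : exists r : F, (r ^+ (p ^ n).-1 = -1)%R.
  by apply: closed_pow_root; lia.
have r_neq0 : (r != 0)%R.
  apply/eqP => r0; move/eqP: r_pow; rewrite r0 expr0n gtn_eqF; last by lia.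
  by rewrite eq_sym oppr_eq0 oner_eq0.
(* The map x -> x^(p^n) sends [r] to [- r] and, [p] being odd, [- r] back to [r]; only the parity of
   the number of iterations matters. *)
have r_frob j : odd j -> (r ^+ (p ^ (n * j)) = - r)%R.
  have r1 : (r ^+ (p ^ n) = - r)%R.
    by rewrite -[p ^ n]prednK ?expn_gt0 ?prime_gt0 // exprSr r_pow mulN1r.
  have rN : ((- r) ^+ (p ^ n) = r)%R.
    by rewrite exprNn -signr_odd oddX hodd orbT expr1 r1 mulrNN mul1r.
  move=> odd_j; rewrite -(odd_double_half j) odd_j; elim: (j./2) => [|i IHi].
    by rewrite muln1.
  by rewrite doubleS !addnS !mulnS !expnD !exprM r1 rN -exprM -expnD -mulnS IHi.
pose b := (size s == n + 1 : nat).
(* The empty subset contributes only when n = 1: 1 from the average with u = 1 and [r^-1] from the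
   one with u = [r]. *)
pose c0 : {poly F} := ((1 + r^-1)%:P *+ (n == 1))%R.
(* Here [z ^+ (i * (n - 1))] is the inverse of [z ^+ i]. Each term is a scalar times a K-th
   power. *)
pose term (u : F) (y : {poly F}) (i : 'I_n) :=
  ((z ^+ (i * (n - 1)) * u^-1)%:P * (1 + (z ^+ i * u)%:P * y) ^+ K)%R.
have term_sum u y : (\sum_i term u y i = n%:R * ((u^-1)%:P * ((n == 1)%:R
   + \sum_l (u%:P * y) ^+ (p ^ e l) + (u%:P * y) ^+ K *+ b)))%R.
  have := @root_of_unity_filter {poly F} p n _ e z%:P (u%:P * y)%R.
  rewrite fmorph_primitive_root (pchar_lalg {poly F}) => /(_ hchar prim_z).
  rewrite s_gt0 => /(_ hc pe1) E.
  rewrite mulrCA -E mulr_sumr; apply: eq_bigr => i _.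
  by rewrite /term !rmorphM !rmorphXn /= !mulrA [(_ * u^-1%:P)%R]mulrC.
(* The coefficient of [y] in [key]: [n] from summing over the roots of unity, 2 from the two values
   of u, [k %% p] from the zero exponents. *)
pose A : F := ((n * (2 * (k %% p)))%:R)%R.
have A_neq0 : (A != 0)%R.
  rewrite nat_neq0 !Euclid_dvdM // !negb_or p_ndvd_pow2 (p_ndvd_pow2 1).
  by rewrite /dvdn modn_mod -/(dvdn p k) -prime_coprime // coprime_sym.
have rr : (r^-1 * r = 1)%R by rewrite mulVf.
have key y : (\sum_i term 1%R y i + \sum_i term r y i =
    n%:R * c0 + A%:P * y + (n%:R * (1 + r^-1 * r ^+ K))%:P * y ^+ K *+ b)%R.
  have linear : (\sum_l y ^+ (p ^ e l) + (r^-1)%:P * \sum_l (r%:P * y) ^+ (p ^ e l)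
      = (2 * (k %% p))%:R * y)%R.
    rewrite mulr_sumr -big_split /=.
    rewrite (eq_bigr (fun l : 'I_(size s) =>
        if nth 0 s l == 0 then (2%:R * y)%R else 0%R)); last first.
      move=> l _; rewrite exprMn -rmorphXn /= mulrA -polyCM /e.
      have [_ h0 dvd_h odd_h] := h_spec (nth 0 s l).
      case: (nth 0 s l =P 0) => [l0 | /eqP]; last rewrite -lt0n => /odd_h{}odd_h.
        by move/eqP: h0; rewrite l0 => /eqP/eqP->; rewrite expn0 !expr1 rr; ring.
      rewrite -[h _](divnK dvd_h) mulnC.
      by rewrite r_frob // mulrN rr polyCN mulN1r subrr.
    rewrite -(big_mkord xpredT (fun i => if nth 0 s i == 0 then (2%:R * y)%R else 0%R)).
    rewrite -(big_nth 0 xpredT (fun x => if x == 0 then (2%:R * y)%R else 0%R)).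
    rewrite -big_mkcond big_const_seq iter_addr_0 -count_s /=.
    by rewrite natrM -mulr_natr; ring.
  rewrite !term_sum invr1 !mul1r -mulrDr.
  have -> : (A%:P = n%:R * (2 * (k %% p))%:R :> {poly F})%R.
    by rewrite /A natrM rmorphM !rmorph_nat.
  rewrite -[(n%:R * _%:R * y)%R]mulrA -linear /c0 
    !(rmorphM, rmorphD, rmorph1, rmorphXn, rmorph_nat) /=.
  rewrite exprMn; move: (n%:R)%R (y ^+ K)%R (r%:P ^+ K)%R (nat_of_bool _) {term_sum} b => N Y Z d b.
  move: (\sum_l y ^+ (p ^ e l))%R (\sum_l (r%:P * y) ^+ (p ^ e l))%R => L1 L2.
  ring.
(* This [y] solves A y + n c0 = f. The leftover multiple of [y ^+ K] changes sides and costs the one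
   extra power, beyond the 2n terms of the two sums. *)
move=> f; pose y := ((A^-1)%:P * (f - n%:R * c0))%R.
have -> : f = ((\sum_i term 1%R y i + \sum_i term r y i)
    + (- (n%:R * (1 + r^-1 * r ^+ K)))%:P * y ^+ K *+ b)%R.
  rewrite key /y mulrA -polyCM divff // mul1r polyCN mulNr mulNrn; ring.
rewrite expnS mul2n -addnn; apply: sum_kth_powers_leD.
  by apply: sum_kth_powers_leD; apply: sum_kth_powers_le_sum => i; apply: scaled_power.
by rewrite /b; case: eqP => _; [apply: scaled_power | exists [::]; rewrite big_nil].
Qed.
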